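(* Let $K$ be a field of characteristic zero, and let $I$ be an Artinian ideal in $R = K[x,y,z]$ generated by monomials whose degrees are bounded above by $d$. Let $T = T_d(I)$. If $T$ is non-empty, then any two of the following conditions imply the third: (i) $I$ is perfectly-punctured (in degree $d$); (ii) $T$ is tileable; (iii) the syzygy bundle $\widetilde{\operatorname{syz} I}$ on $\mathbb{P}^2$ is semistable.
   Context: For $d\ge 1$, $\mathcal{T}_d$ is the equilateral triangle of side length $d$ subdivided into equilateral unit triangles. Its downward-pointing unit triangles are labelled bijectively by the monomials of degree $d-2$ in $x,y,z$, and its upward-pointing unit triangles by the monomials of degree $d-1$, with $x^{d-1}$ at the top, $y^{d-1}$ at the bottom-left, $z^{d-1}$ at the bottom-right; a downward-pointing triangle with label $n$ and an upward-pointing triangle with label $m$ share an edge if and only if $m\in\{xn,yn,zn\}$. For a monomial ideal $I$, the region $T_d(I)$ is the set of unit triangles of $\mathcal{T}_d$ whose label is not in $I$. A lozenge is the union of two unit triangles sharing an edge. A region is tileable if it is empty or can be partitioned into lozenges. If $g_1,\dots,g_m$ are the minimal monomial generators of $I$, all of degree at most $d$, the over-puncturing coefficient of $I$ in degree $d$ is $\mathfrak{o}_d(I)=\sum_{i=1}^m (d-\deg g_i) - d$; $I$ is perfectly-punctured in degree $d$ if $\mathfrak{o}_d(I)=0$. The syzygy module $\operatorname{syz} I$ is the kernel of the surjection $\bigoplus_{i=1}^m R(-\deg g_i)\to I$ given by the minimal generators, and the syzygy bundle $\widetilde{\operatorname{syz} I}$ is its sheafification, a vector bundle of rank $m-1$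 on $\mathbb{P}^2$. A vector bundle $E$ is semistable if $\mu(F)\le\mu(E)$ for every non-zero coherent subsheaf $F\subset E$, where $\mu=c_1/\operatorname{rk}$. (By a theorem of Brenner, for monomial ideals in characteristic zero this is equivalent to: for every proper subset $J\subset\{1,\dots,m\}$ with at least two elements, $\frac{d_J-\sum_{j\in J}\deg g_j}{|J|-1}\le\frac{-\sum_{i=1}^m\deg g_i}{m-1}$, where $d_J$ is the degree of $\gcd\{g_j: j\in J\}$; this may be taken as the definition of semistability.) *)

(* Defs.v *)
From HB Require Import structures.
From mathcomp Require Import all_boot all_order all_algebra.
From mathcomp Require Export mpoly.

Set Implicit Arguments.
Unset Strict Implicit.
Unset Printing Implicit Defensive.

Import GRing.Theory.
Local Open Scope ring_scope.

(* K[x,y,z] is {mpoly K[3]}; a monomial x^a y^b z^c is a multi-exponent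
   in 'X_{1..3}, seen as a polynomial through 'X_[_].  An ideal is given by its
   membership predicate. *)
Section MonomialIdeals.
Variable K : fieldType.
Implicit Types (I J : {pred {mpoly K[3]}}) (m : nat).

(* The ideal (1) is allowed, contrary to idealr_closed. *)
Definition is_ideal J : Prop :=
  [/\ 0 \in J, {in J &, forall p q, p + q \in J}
    & forall a, {in J, forall p, a * p \in J}].

(* p lies in the ideal generated by the monomials g i such that P i. *)
Definition in_gen_ideal m (g : 'I_m -> 'X_{1..3}) (P : pred 'I_m)
    (p : {mpoly K[3]}) : Prop :=
  exists c : 'I_m -> {mpoly K[3]}, p = \sum_(i < m | P i) c i * 'X_[g i].

Definition generated_by I m (g : 'I_m -> 'X_{1..3}) : Prop :=
  forall p, (p \in I) <-> in_gen_ideal g predT p.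

Definition generated_by_monomials_le (d : nat) I : Prop :=
  exists (m : nat) (g : 'I_m -> 'X_{1..3}),
    generated_by I g /\ forall i, (mdeg (g i) <= d)%N.

Definition minimal_generators I m (g : 'I_m -> 'X_{1..3}) : Prop :=
  generated_by I g /\ forall i, ~ in_gen_ideal g (predC1 i) 'X_[g i].

(* R/I is an Artinian ring: descending chain condition on the ideals of R
   containing I. *)
Definition artinian I : Prop :=
  forall J : nat -> {pred {mpoly K[3]}},
    (forall n, [/\ is_ideal (J n), {subset I <= J n}
                 & {subset J n.+1 <= J n}]) ->
    exists N, forall n, (N <= n)%N -> J n =i J N.

End MonomialIdeals.

(* The unit triangles of T_d are identified with their labels: the monomials of
   degree d-1 are the upward-pointing triangles, those of degree d-2 are the
   downward-pointing ones. *)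
Definition is_up d (t : 'X_{1..3 < d}) : bool := (mdeg t).+1 == d.
Definition is_down d (t : 'X_{1..3 < d}) : bool := (mdeg t).+2 == d.

Definition region (K : fieldType) (d : nat) (I : {pred {mpoly K[3]}}) :
    {set 'X_{1..3 < d}} :=
  [set t : 'X_{1..3 < d} |
     (is_up t || is_down t) && (('X_[t] : {mpoly K[3]}) \notin I)].

Definition share_edge d (n m : 'X_{1..3 < d}) : bool :=
  [&& is_down n, is_up m &
      [exists i : 'I_3, (m : 'X_{1..3}) == (U_(i) + n)%MM]].

Definition is_lozenge d (B : {set 'X_{1..3 < d}}) : Prop :=
  exists n m, share_edge n m /\ B = [set n; m].

Definition tileable d (T : {set 'X_{1..3 < d}}) : Prop :=
  T = set0 \/
  exists P : {set {set 'X_{1..3 < d}}},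
    partition P T /\ {in P, forall B, is_lozenge B}.

Section Generators.
Variables (m : nat) (g : 'I_m -> 'X_{1..3}).

Definition overpuncturing (d : nat) : int :=
  \sum_(i < m) (d%:Z - (mdeg (g i))%:Z) - d%:Z.

Definition perfectly_punctured (d : nat) : Prop := overpuncturing d = 0.

(* The greatest common divisor of the g j, j in J (J nonempty): the exponents
   are minima over J, the default value of the iterated minimum being an upper
   bound of the family. *)
Definition gcd_monomial (J : {set 'I_m}) : 'X_{1..3} :=
  [multinom \big[minn/(\max_(j in J) g j k)%N]_(j in J) g j k | k < 3].

(* Semistability of the syzygy bundle of the monomial ideal minimally generated
   by g in characteristic zero, in the form given by Brenner: the slope of the
   syzygy subbundle of each proper subfamily of at least two generators is at
   most the slope of the whole bundle. *)
Definition syzygy_bundle_semistable : Prop :=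
  forall J : {set 'I_m}, J \proper [set: 'I_m] -> (1 < #|J|)%N ->
    ((mdeg (gcd_monomial J))%:R - \sum_(j in J) (mdeg (g j))%:R)
      / (#|J|%:R - 1)
    <= (- \sum_(i < m) (mdeg (g i))%:R) / (m%:R - 1) :> rat.

End Generators.

(* Main.v *)
(* Let [g_1, ..., g_m] be the minimal generators of [I], [a_j] their degrees and
   [o] the over-puncturing coefficient.  The multiples of a monomial [h] form a
   triangle of side [d - deg h], and this side is its number of upward minus
   downward unit triangles, its excess.  Semistability says that, for every
   nonempty set [J] of generators, [sum_J (d - a_j)] is at most
   [d - deg gcd_J + o (|J| - 1) / (m - 1)].

   Any set of unit triangles that contains, with each of its downward triangles,
   the three neighbours of it, is covered by pairwise disjoint triangles whose
   sides add up to at most its excess.  As a puncture inside the set lies in a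
   single triangle of the cover, semistability bounds the total side of a family
   of punctures by the excess of any such set that contains them.

   - (i), (ii) => (iii): if [T] is balanced and [o = 0], the punctures do not
     overlap, and a tiling of [T] shows that the punctures inside a triangle have
     total side at most its side.
   - (i), (iii) => (ii): the bound on families of punctures gives Hall's
     condition for matching the downward triangles with the upward ones.
   - (ii), (iii) => (i): if [o > 0], then every row of unit triangles, in each of
     the three directions, meets the punctures, for otherwise the bound, applied
     to both sides of the row, would be violated.  As [T] is balanced, the
     punctured part of each row is connected; hence the border of the big
     triangle, then every row, is punctured, and [T] is empty. *)
Require Import Defs.
From HB Require Import structures.
From mathcomp Require Import all_boot all_order all_algebra.
From mathcomp Require Import mpoly.
From mathcomp Require Import zify ring lra.

Set Implicit Arguments.
Unset Strict Implicit.
Unset Printing Implicit Defensive.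

Import Order.TTheory GRing.Theory Num.Theory.
Local Open Scope ring_scope.

(** * Hall's marriage theorem *)

Section HallMarriage.
Variables (X Y : finType).
Implicit Types (A S : {set X}) (r : X -> {set Y}).

(** Induction on the size of [A]. A nonempty proper subset without a neighbour to spare is matched
    first, and its neighbours are withdrawn from the rest. If there is no such subset, any [x] may
    take any of its neighbours. *)
Lemma hall_marriage (y0 : Y) A r :
    (forall S, S \subset A -> (#|S| <= #|\bigcup_(x in S) r x|)%N) ->
  exists2 f : X -> Y, {in A &, injective f} & {in A, forall x, f x \in r x}.
Proof.
have [n] := ubnP #|A|; elim: n A r => // n IHn A r leAn hallA.
have [->|[x Ax]] := set_0Vmem A.
  by exists (fun=> y0) => [x y|x]; rewrite inE.
have [/existsP[S /and4P[SA S0 SnA tightS]]|noTight] :=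
    boolP [exists S : {set X}, [&& S \subset A, S != set0, S != A
                 & #|\bigcup_(x in S) r x| == #|S|]].
  have SpA : S \proper A by rewrite properEneq SnA.
  have cardS : (#|S| < #|A|)%N by apply: proper_card.
  have [|S' S'S|f fI fr] := IHn S r; first by lia.
    by apply: hallA; apply: subset_trans S'S SA.
  set N := \bigcup_(x in S) r x.
  have cardAS : (#|A :\: S| < n)%N.
    have := cardsID S A; rewrite (setIidPr SA).
    by rewrite -card_gt0 in S0; lia.
  have [//|S' S'AS|f' f'I f'r] := IHn (A :\: S) (fun x => r x :\: N).
    have S'A : S' \subset A by apply: subset_trans S'AS (subsetDl _ _).
    have dSS' : S :&: S' = set0.
      apply/setP=> z; rewrite !inE; apply/negP=> /andP[zS /(subsetP S'AS)].
      by rewrite !inE zS.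
    (* As [S] is tight, the condition for [S :|: S'] leaves at least [#|S'|] neighbours outside
       [N]. *)
    have := hallA (S :|: S'); rewrite subUset SA S'A => /(_ isT).
    rewrite cardsU dSS' cards0 subn0 => le1.
    have sub : \bigcup_(x in S :|: S') r x
               \subset N :|: \bigcup_(x in S') (r x :\: N).
      apply/bigcupsP=> z; rewrite inE => /orP[zS|zS'].
        by apply: subsetU; rewrite bigcup_sup.
      apply/subsetP=> y yz; rewrite inE; case: (boolP (y \in N)) => //= yN.
      by apply/bigcupP; exists z; rewrite // inE yN.
    have := subset_leq_card sub; rewrite cardsU; move: (eqP tightS); rewrite -/N.
    by lia.
  exists (fun z => if z \in S then f z else f' z) => [u v uA vA|u uA].
    have disj a b : a \in S -> b \in A -> b \notin S -> f a <> f' b.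
      move=> aS bA bS eab; have := f'r b; rewrite !inE bS bA -eab => /(_ isT).
      by case/andP=> /negP[]; apply/bigcupP; exists a; rewrite ?fr.
    case: ifPn => uS; case: ifPn => vS.
    - exact: fI.
    - by move/disj; case.
    - by move/esym/disj; case.
    - by apply: f'I; rewrite inE ?uS ?vS.
  case: ifPn => uS; first exact: fr.
  by have := f'r u; rewrite !inE uS uA => /(_ isT)/andP[].
have [y yx] : exists y, y \in r x.
  have := hallA [set x]; rewrite sub1set Ax big_set1 cards1 => /(_ isT).
  by rewrite card_gt0 => /set0Pn.
have [|S SAx|f fI fr] := IHn (A :\ x) (fun z => r z :\ y).
- by have := cardsD1 x A; rewrite Ax; lia.
- have SA : S \subset A by apply: subset_trans SAx (subsetDl _ _).
  have [->|S0] := eqVneq S set0; first by rewrite cards0.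
  have SnA : S != A.
    by apply: contraTneq SAx => ->; apply/subsetPn; exists x; rewrite // !inE eqxx.
  (* Every such [S] has a neighbour to spare, so it can afford the loss of [y]. *)
  move/existsPn/(_ S): noTight; rewrite SA S0 SnA /= => nt.
  have le1 := hallA S SA.
  have sub : (\bigcup_(z in S) r z) :\ y \subset \bigcup_(z in S) (r z :\ y).
    apply/subsetP=> u; rewrite !inE => /andP[uy /bigcupP[z zS uz]].
    by apply/bigcupP; exists z; rewrite // !inE uy.
  have := subset_leq_card sub; have := cardsD1 y (\bigcup_(z in S) r z).
  by case: (_ \in _) => /=; lia.
have fy z : z \in A -> z != x -> f z != y.
  by move=> zA zx; have := fr z; rewrite !inE zx zA => /(_ isT)/andP[].
exists (fun z => if z == x then y else f z) => [u v uA vA|u uA].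
  case: eqVneq => [->|ux]; case: eqVneq => [->|vx] //.
  - by move/esym/eqP; rewrite (negPf (fy _ _ _)).
  - by move/eqP; rewrite (negPf (fy _ _ _)).
  - by apply: fI; rewrite !inE ?ux ?vx.
case: eqVneq => [->//|ux].
by have := fr u; rewrite !inE ux uA => /(_ isT)/andP[].
Qed.

End HallMarriage.

(** * Monomials in three variables, coordinate by coordinate *)

Section Coordinates.
Implicit Types (h u v : 'X_{1..3}) (i j k : 'I_3).

(** The hypothesis [uniq [:: i; j; k]] lists the three variables in an arbitrary order, so that
    later arguments serve all directions at once. *)
Lemma ord3_uniq_cover i j k s : uniq [:: i; j; k] -> [|| s == i, s == j | s == k].
Proof.
rewrite /= !inE negb_or -!(inj_eq val_inj) /= andbT.
case: i j k s => [i ?] [j ?] [k ?] [s ?] /=; lia.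
Qed.

Lemma uniq3_neq i j k : uniq [:: i; j; k] -> [/\ i != j, i != k & j != k].
Proof. by rewrite /= !inE negb_or andbT => /andP[/andP[-> ->] ->]. Qed.

Lemma mdeg_coords i j k u :
  uniq [:: i; j; k] -> mdeg u = (u i + u j + u k)%N.
Proof.
move=> uijk; have [ij ik jk] := uniq3_neq uijk.
rewrite mdegE (bigD1 i) //= (bigD1 j) 1?eq_sym //= (bigD1 k) /=; last first.
  by rewrite ![k == _]eq_sym ik.
rewrite big1 ?addn0 ?addnA // => s /andP[/andP[si sj] sk].
by have := ord3_uniq_cover s uijk; rewrite (negPf si) (negPf sj) (negPf sk).
Qed.

Lemma mnm_le_coords i j k h u : uniq [:: i; j; k] ->
  (h <= u)%MM = [&& (h i <= u i)%N, (h j <= u j)%N & (h k <= u k)%N].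
Proof.
move=> uijk; apply/mnm_lepP/and3P => [le|[lei lej lek] s]; first by [].
by have /or3P[/eqP->|/eqP->|/eqP->] := ord3_uniq_cover s uijk.
Qed.

Lemma mnm_eq_coords i j k u v : uniq [:: i; j; k] ->
  u i = v i -> u j = v j -> u k = v k -> u = v.
Proof.
move=> uijk ei ej ek; apply/mnmP=> s.
by have /or3P[/eqP->|/eqP->|/eqP->] := ord3_uniq_cover s uijk.
Qed.

Lemma mnm_of_coords i j k a b c : uniq [:: i; j; k] ->
  exists u, [/\ u i = a, u j = b & u k = c].
Proof.
move=> uijk; exists [multinom if s == i then a else if s == j then b else c | s < 3].
have [ij ik jk] := uniq3_neq uijk.
by rewrite !mnmE !eqxx (eq_sym j i) (eq_sym k i) (eq_sym k j) (negPf ij) (negPf ik) (negPf jk).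
Qed.

Lemma exists_uniq3 i : exists j k, uniq [:: i; j; k].
Proof.
case: i => [[|[|[]]]] // lti.
- by exists (@Ordinal 3 1 isT), (@Ordinal 3 2 isT).
- by exists (@Ordinal 3 0 isT), (@Ordinal 3 2 isT).
- by exists (@Ordinal 3 0 isT), (@Ordinal 3 1 isT).
Qed.

End Coordinates.

(** * Unit triangles and the excess of a weight *)

Section Triangles.
Variable d : nat.
Local Notation M := 'X_{1..3 < d}.
Implicit Types (n u v : M) (h g : 'X_{1..3}) (i j k : 'I_3) (f : M -> int).
Implicit Types (V : {set M}) (H : seq 'X_{1..3}).

Lemma up_not_down u : is_up u -> ~~ is_down u.
Proof. by rewrite /is_up /is_down; lia. Qed.

(** For downward [n] the product has degree [d - 1], so the default value of [insubd] does not
    occur. *)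
Definition times i n : M := insubd n (U_(i) + n)%MM.

Lemma timesE i n : is_down n -> times i n = (U_(i) + n)%MM :> 'X_{1..3}.
Proof.
move=> /eqP dn; rewrite /times val_insubd mdegD mdeg1 add1n.
by case: ifP => // /negbT; lia.
Qed.

Lemma times_coord i n s : is_down n -> times i n s = ((i == s) + n s)%N.
Proof. by move=> /timesE->; rewrite mnmDE mnm1E. Qed.

Lemma times_up i n : is_down n -> is_up (times i n).
Proof. by move=> dn; rewrite /is_up timesE // mdegD mdeg1. Qed.

Lemma times_inj i : {in @is_down d &, injective (times i)}.
Proof.
move=> n n' dn dn' /(congr1 (@bmnm 3 d)); rewrite !timesE // => /addmI e.
exact: val_inj.
Qed.

Lemma up_times i u : is_up u -> (0 < u i)%N -> exists2 n, is_down n & times i n = u.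
Proof.
move=> upu ui; have le1u : (U_(i) <= u)%MM by rewrite lep1mP -lt0n.
have degn : (mdeg (u - U_(i))%MM).+1 = mdeg u.
  by rewrite -{2}(submK le1u) mdegD mdeg1 addn1.
have ltn : (mdeg (u - U_(i))%MM < d)%N.
  by have := bmdeg u; rewrite -degn => /ltnW.
exists (BMultinom ltn); first by rewrite /is_down /= degn.
by apply: val_inj; rewrite /= timesE /= ?/is_down /= ?degn // addmC submK.
Qed.

Lemma share_edgeP n u :
  reflect (is_down n /\ exists i, u = times i n) (share_edge n u).
Proof.
apply: (iffP and3P) => [[dn _ /existsP[i /eqP e]]|[dn [i ->]]].
  by split=> //; exists i; apply: val_inj; rewrite /= timesE.
by split; rewrite ?times_up //; apply/existsP; exists i; rewrite timesE.
Qed.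

(** The excess of a set is that of its indicator; general weights also express punctures counted
    with multiplicity. *)
Definition excess f : int := \sum_(u : M | is_up u) f u - \sum_(n | is_down n) f n.

Lemma excess_ext f f' :
  (forall u, is_up u || is_down u -> f u = f' u) -> excess f = excess f'.
Proof.
by move=> ff'; congr (_ - _); apply: eq_bigr => u uP; apply: ff'; rewrite uP ?orbT.
Qed.

Lemma excessD f f' : excess (fun u => f u + f' u) = excess f + excess f'.
Proof. by rewrite /excess !big_split /=; ring. Qed.

Lemma excessB f f' : excess (fun u => f u - f' u) = excess f - excess f'.
Proof. by rewrite /excess !sumrB; ring. Qed.

Lemma excess_sum (J : finType) (P : pred J) (F : J -> M -> int) :
  excess (fun u => \sum_(j | P j) F j u) = \sum_(j | P j) excess (F j).
Proof.
rewrite /excess sumrB; congr (_ - _); exact: exchange_big.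
Qed.

(** Multiplication by the variable [i] is a bijection from the downward triangles onto the upward
    ones with positive exponent of [i]. The second sum is over the upward triangles it misses, along
    one side. *)
Lemma excess_times i f :
  excess f = \sum_(n | is_down n) (f (times i n) - f n)
             + \sum_(u : M | is_up u && (u i == 0%N)) f u.
Proof.
rewrite /excess (bigID (fun u : M => u i == 0%N)) /= sumrB.
suff -> : \sum_(u : M | is_up u && (u i != 0%N)) f u =
  \sum_(n | is_down n) f (times i n) by ring.
transitivity (\sum_(u in times i @: [set n | is_down n]) f u).
  apply: eq_bigl => u; apply/andP/imsetP => [[upu]|[n]].
    by rewrite -lt0n => /(up_times upu)[n dn <-]; exists n; rewrite ?inE.
  by rewrite inE => dn ->; rewrite times_up // times_coord // eqxx.
rewrite big_imset /=; first by apply: eq_bigl => n; rewrite inE.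
by move=> n n'; rewrite !inE; apply: times_inj.
Qed.

Lemma excess_ge0 i f :
    (forall u, is_up u -> 0 <= f u) ->
    (forall n, is_down n -> f n <= f (times i n)) ->
  0 <= excess f.
Proof.
move=> f0 fX; rewrite (excess_times i) addr_ge0 ?sumr_ge0 // => u.
  by move=> /fX; rewrite subr_ge0.
by case/andP=> /f0.
Qed.

(** All terms of [excess_times] are nonnegative, so each of them vanishes with the total. *)
Lemma excess_eq0 i f :
    (forall u, is_up u -> 0 <= f u) ->
    (forall n, is_down n -> f n <= f (times i n)) ->
    excess f = 0 ->
  (forall n, is_down n -> f (times i n) = f n)
  /\ (forall u, is_up u -> u i = 0%N -> f u = 0).
Proof.
move=> f0 fX; rewrite (excess_times i) => /eqP.
have p1 : forall n, is_down n -> 0 <= f (times i n) - f n.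
  by move=> n /fX; rewrite subr_ge0.
have p2 : forall u : M, is_up u && (u i == 0%N) -> 0 <= f u.
  by move=> u /andP[/f0].
rewrite paddr_eq0 ?sumr_ge0 // !psumr_eq0 // => /andP[/allP e1 /allP e2].
split=> [n dn|u upu ui].
  by apply/eqP; rewrite -subr_eq0; have := e1 n (mem_index_enum _); rewrite dn.
by apply/eqP; have := e2 u (mem_index_enum _); rewrite upu ui.
Qed.

Lemma excess_ind (P : pred M) :
  excess (fun u => (P u)%:R)
  = #|[set u | is_up u && P u]|%:Z - #|[set n | is_down n && P n]|%:Z.
Proof.
have sum_ind (Q : pred M) : \sum_(u | Q u) (P u)%:R = #|[set u | Q u && P u]|%:Z.
  rewrite -natz -sum1_card natr_sum [RHS]big_mkcond [LHS]big_mkcond.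
  by apply: eq_bigr => u _; rewrite inE; case: (Q u); case: (P u).
by rewrite /excess !sum_ind.
Qed.

(** Multiplication by one variable pairs the downward multiples of [h] with upward ones; the
    unpaired upward multiples form the row [B] along a side of the triangle. *)
Lemma excess_multiples h : (mdeg h <= d)%N ->
  excess (fun u => (h <= u)%MM%:R) = d%:Z - (mdeg h)%:Z.
Proof.
move=> hd; rewrite excess_ind.
pose i := @Ordinal 3 0 isT; pose j := @Ordinal 3 1 isT; pose k := @Ordinal 3 2 isT.
have uijk : uniq [:: i; j; k] by [].
have leE := mnm_le_coords _ _ uijk; have degE := mdeg_coords _ uijk.
set D := [set n | is_down n && (h <= n)%MM]; set U := [set u | _].
pose B := [set u in U | u i == h i].
have UE : U = times i @: D :|: B.
  apply/setP=> u; rewrite !inE; apply/idP/idP => [/andP[upu hu]|].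
    rewrite upu hu /=; case: (eqVneq (u i) (h i)) => [|uh]; rewrite ?orbT //= orbF.
    have lti : (h i < u i)%N by rewrite ltn_neqAle eq_sym uh (mnm_lepP hu).
    have [n dn nu] := up_times upu (leq_ltn_trans (leq0n _) lti).
    apply/imsetP; exists n => //; rewrite inE dn /=; move: hu lti.
    by rewrite !leE -nu !times_coord //=; lia.
  case/orP=> [/imsetP[n]|/andP[] //]; rewrite inE => /andP[dn hn] ->.
  by rewrite times_up // timesE // (lepm_trans hn) // lem_addl.
have disj : times i @: D :&: B = set0.
  apply/setP=> u; rewrite !inE; apply/negP => /andP[/imsetP[n]].
  rewrite inE => /andP[dn hn] -> /andP[_]; rewrite times_coord // eqxx.
  by have := mnm_lepP hn i; lia.
have cardB : #|B| = (d - mdeg h)%N.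
  (* The row is parametrized by the surplus of the exponent of [j]; the exponent of [k] completes
     the degree to [d - 1]. *)
  have exF (a : 'I_(d - mdeg h)) : exists u,
    [/\ is_up u, u i = h i, u j = (h j + a)%N & (h k <= u k)%N].
    have [v [vi vj vk]] := mnm_of_coords (h i) (h j + a) (h k + (d - mdeg h - a.+1)) uijk.
    have dv : (mdeg v).+1 = d.
      by have := ltn_ord a; have := degE h; have := degE v; rewrite vi vj vk; lia.
    have ltv : (mdeg v < d)%N by rewrite dv.
    by exists (BMultinom ltv); rewrite /is_up /= dv; split => //; lia.
  have [F HF] := fin_all_exists exF.
  have injF : injective F.
    move=> a b eab; apply: val_inj; have [_ _ ea _] := HF a; have [_ _ eb _] := HF b.
    by move: eb; rewrite -eab ea => /addnI.
  rewrite -[RHS]card_ord -(card_imset _ injF); apply: eq_card => u.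
  rewrite !inE; apply/idP/imsetP => [|[a _ ->]]; last first.
    by have [-> ei ej ek] := HF a; rewrite leE ei ej ek eqxx !leqnn leq_addr.
  rewrite leE => /andP[/andP[upu /and3P[ui uj uk]] /eqP eui].
  have ltB : (u j - h j < d - mdeg h)%N.
    by move: upu; rewrite /is_up degE (degE h); lia.
  exists (Ordinal ltB) => //; have [upa ei ej ek] := HF (Ordinal ltB).
  apply: val_inj; apply: (mnm_eq_coords uijk) => /=; rewrite ?ei ?ej /=; try lia.
  by move: upu upa; rewrite /is_up !degE ei ej /=; lia.
rewrite UE cardsU disj cards0 subn0 cardB card_in_imset; last first.
  by move=> n n'; rewrite !inE => /andP[dn _] /andP[dn' _]; apply: times_inj.
by lia.
Qed.
End Triangles.

(** * Covering saturated sets by triangles *)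

Section Covers.
Variable d : nat.
Local Notation M := 'X_{1..3 < d}.
Implicit Types (n u v : M) (h g : 'X_{1..3}) (i j k : 'I_3).
Implicit Types (V : {set M}) (H : seq 'X_{1..3}).

Definition saturated V :=
  forall n i, is_down n -> n \in V -> times i n \in V.

(** A monomial [h] in [H] stands for the triangle of its multiples. Members of [V] of degree below
    [d - 2] are no unit triangles. *)
Definition covers H V :=
  forall u, u \in V -> is_up u || is_down u -> has (fun h => (h <= u)%MM) H.

Definition side_sum H : int := \sum_(h <- H) (d%:Z - (mdeg h)%:Z).

Definition excess_set V := excess (fun u => (u \in V)%:R).

Definition gcd_mnm h h' : 'X_{1..3} := [multinom minn (h i) (h' i) | i < 3].

Lemma gcd_mnm_le h h' : (gcd_mnm h h' <= h)%MM /\ (gcd_mnm h h' <= h')%MM.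
Proof. by split; apply/mnm_lepP => i; rewrite mnmE ?geq_minl ?geq_minr. Qed.

Lemma mdeg_gcd h h' : (mdeg (gcd_mnm h h') + mdeg (mlcm h h') = mdeg h + mdeg h')%N.
Proof.
rewrite !mdegE -!big_split /=; apply: eq_bigr => i _; rewrite !mnmE.
by rewrite addn_min_max.
Qed.

Lemma mdeg_le h g : (h <= g)%MM -> (mdeg h <= mdeg g)%N.
Proof. by move=> /mnm_lepP le; rewrite !mdegE; apply: leq_sum. Qed.

(* Two triangles sharing a corner, or overlapping, lie in a triangle whose side
   is at most the sum of the two sides. *)
Lemma merge_cover H V h h' b :
    all (fun h => (mdeg h < d)%N) H -> covers H V -> h \in H -> h' \in H ->
    h != h' -> (mdeg (mlcm h h') <= b)%N -> (b <= d)%N ->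
  exists H', [/\ all (fun h => (mdeg h < d)%N) H', covers H' V,
    (size H' < size H)%N, gcd_mnm h h' \in H'
    & side_sum H' <= side_sum H + b%:Z - d%:Z].
Proof.
move=> degH cov hH h'H hh' lcmb bd.
have h'rem : h' \in rem h H.
  by have := perm_mem (perm_to_rem hH) h'; rewrite h'H inE eq_sym (negPf hh').
have pH : perm_eq H [:: h, h' & rem h' (rem h H)].
  by rewrite (perm_trans (perm_to_rem hH)) // perm_cons perm_to_rem.
have [gh gh'] := gcd_mnm_le h h'.
exists (gcd_mnm h h' :: rem h' (rem h H)); split.
- have := degH; rewrite !(perm_all _ pH) /= => /and3P[dh _ ->]; rewrite andbT.
  exact: leq_ltn_trans (mdeg_le gh) dh.
- move=> u uV /(cov u uV); rewrite (perm_has _ pH) /= => /or3P[hu|hu|->].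
  + by rewrite (lepm_trans gh hu).
  + by rewrite (lepm_trans gh' hu).
  + by rewrite orbT.
- by rewrite (perm_size pH).
- by rewrite inE eqxx.
- rewrite /side_sum (perm_big _ pH) /= !big_cons.
  by have := mdeg_gcd h h'; set S := \sum_(_ <- _) _; lia.
Qed.

Let x : 'I_3 := @Ordinal 3 0 isT.
Let y : 'I_3 := @Ordinal 3 1 isT.
Let z : 'I_3 := @Ordinal 3 2 isT.

Lemma excess_setE V :
  excess_set V = #|[set u in V | is_up u]|%:Z - #|[set n in V | is_down n]|%:Z.
Proof.
rewrite /excess_set excess_ind.
by congr (_%:Z - _%:Z); apply: eq_card => u; rewrite !inE andbC.
Qed.

Lemma excess_setD1_pair V n u : n \in V -> u \in V -> is_down n -> is_up u ->
  excess_set (V :\ n :\ u) = excess_set V.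
Proof.
move=> nV uV dn upu; rewrite !excess_setE.
have nup : is_up n = false by apply: contraTF dn => /up_not_down.
have ndu : is_down u = false := negbTE (up_not_down upu).
have -> : [set v in V :\ n :\ u | is_up v] = [set v in V | is_up v] :\ u.
  apply/setP=> v; rewrite !inE; case: (eqVneq v u) => //= _.
  by case: (eqVneq v n) => [->|vn]; rewrite ?nup ?andbF.
have -> : [set v in V :\ n :\ u | is_down v] = [set v in V | is_down v] :\ n.
  apply/setP=> v; rewrite !inE; case: (eqVneq v u) => [->|vu] /=.
    by rewrite ndu !andbF.
  by rewrite andbA.
rewrite (cardsD1 u [set v in V | is_up v]) (cardsD1 n [set v in V | is_down v]).
rewrite !inE dn upu nV uV /= !PoszD; ring.
Qed.

(** Induction on the number of downward triangles. Without any, the upward triangles themselves, of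
    side 1, form the cover. Otherwise a downward [n] is removed together with [times z n], which
    keeps the excess; if the cover of the rest misses [n], merging two of its triangles repairs this
    at no cost. *)
Lemma triangle_cover V : saturated V ->
  exists H, [/\ all (fun h => (mdeg h < d)%N) H, covers H V
              & side_sum H <= excess_set V].
Proof.
have [N] := ubnP #|[set n in V | is_down n]|; elim: N V => // N IHN V ltN satV.
have [/eqP|[n0]] := set_0Vmem [set n in V | is_down n].
  move=> /eqP noDown; pose U := [set u in V | is_up u].
  exists [seq (u : 'X_{1..3}) | u : M <- enum U]; split.
  - by apply/allP => h /mapP[u _ ->]; apply: bmdeg.
  - move=> u uV /orP[upu|dnu]; last first.
      by have := in_set0 u; rewrite -noDown inE uV dnu.
    apply/hasP; exists (u : 'X_{1..3}); last exact: lepm_refl.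
    by apply: map_f; rewrite mem_enum inE uV.
  rewrite /side_sum big_map big_enum excess_setE noDown.
  rewrite cards0 subr0 -/U (eq_bigr (fun=> 1)) ?sumr_const ?natz //.
  by move=> u; rewrite inE /is_up => /andP[_]; lia.
rewrite inE => n0V.
pose P := [pred n : M | (n \in V) && is_down n].
have n0P : P n0 by [].
case: (@arg_maxnP _ n0 P (fun n : M => n z) n0P) => n /andP[nV dn] nmax {n0 n0V n0P}.
set V' := V :\ n :\ times z n.
(* Another downward triangle of [V] adjacent to [times z n] would have [z]-exponent [n z + 1],
   against the maximality of [n z]. *)
have satV' : saturated V'.
  move=> n' i dn' /[!inE] /and3P[n'z n'n n'V].
  rewrite satV // andbT; apply/andP; split; last first.
    by apply: contraTneq (times_up i dn') => ->; apply: contraL dn => /up_not_down.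
  apply/negP=> /eqP e; have [iz|iz] := eqVneq i z.
    by move: e n'n; rewrite iz => /times_inj -> //; rewrite eqxx.
  have := nmax n' _; rewrite /= n'V dn' => /(_ isT).
  have := times_coord z z dn; rewrite -e times_coord // (negPf iz) eqxx.
  by lia.
have ltV' : (#|[set n' in V' | is_down n']| < N)%N.
  have := cardsD1 n [set n in V | is_down n]; rewrite !inE nV dn /= => cardV.
  have sub : [set n' in V' | is_down n'] \subset [set n in V | is_down n] :\ n.
    by apply/subsetP=> n'; rewrite !inE => /andP[/and3P[_ -> ->] ->].
  rewrite cardV ltnS in ltN; exact: leq_ltn_trans (subset_leq_card sub) ltN.
have [H [degH covH sumH]] := IHN V' ltV' satV'.
have excV' : excess_set V' = excess_set V by rewrite excess_setD1_pair ?times_up ?satV.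
have extend H' : covers H' V' -> has (fun h => (h <= n)%MM) H' -> covers H' V.
  move=> covH' hasn u uV uP; have [->//|un] := eqVneq u n.
  have [->|uz] := eqVneq u (times z n); last by apply: covH'; rewrite ?inE ?un ?uz.
  apply: sub_has hasn => h hn; rewrite timesE //.
  exact: lepm_trans hn (lem_addl _ _).
have [hasn|] := boolP (has (fun h => (h <= n)%MM) H).
  by exists H; split; rewrite -?excV' //; apply: extend.
move=> /hasPn nohas.
have coverT i : i != z -> exists2 h, h \in H & (h <= times i n)%MM.
  move=> iz; apply/hasP; apply: covH; last by rewrite times_up.
  rewrite !inE satV // andbT; apply/andP; split; last first.
    by apply: contraTneq (times_up i dn) => ->; apply: contraL dn => /up_not_down.
  apply/negP => /eqP e; have := times_coord z z dn.
  by rewrite -e times_coord // (negPf iz) eqxx; lia.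
have uxyz : uniq [:: x; y; z] by [].
have leE := mnm_le_coords _ _ uxyz; have degE := mdeg_coords _ uxyz.
(* As neither [h] nor [h'] divides [n], their lcm divides [x y n], of degree [d], and their gcd
   divides [n]. *)
have [h hH] := coverT x isT; have [h' h'H] := coverT y isT.
have := nohas h hH; have := nohas h' h'H; rewrite !leE !times_coord //= !add0n.
move=> nh' nh /and3P[h'x h'y h'z] /and3P[hx hy hz].
have hh' : h != h' by apply/eqP=> e; move: nh hx hy h'x h'y nh'; rewrite e; lia.
have lcmd : (mdeg (mlcm h h') <= d)%N.
  by rewrite degE !mnmE; move: dn; rewrite /is_down degE; lia.
have [H' [degH' covH' _ gH' sumH']] := merge_cover degH covH hH h'H hh' lcmd (leqnn d).
exists H'; split=> //; last by rewrite -excV'; move: sumH'; lia.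
apply: extend => //; apply/hasP; exists (gcd_mnm h h') => //.
by rewrite leE !mnmE; lia.
Qed.

Definition disjoint_cover H :=
  {in H &, forall h h' u, (h <= u)%MM -> (h' <= u)%MM -> h = h'}.

(** Overlapping triangles have an lcm of degree below [d], so merging them does not increase the
    side sum; it shortens the list, hence terminates. *)
Lemma disjoint_triangle_cover V : saturated V ->
  exists H, [/\ all (fun h => (mdeg h < d)%N) H, covers H V,
                side_sum H <= excess_set V & disjoint_cover H].
Proof.
move=> /triangle_cover[H]; have [N] := ubnP (size H).
elim: N H => // N IHN H ltN [degH covH sumH].
have [/hasP[h hH /hasP[h' h'H /andP[hh' /existsP[u /andP[hu h'u]]]]]|noOverlap] :=
  boolP (has (fun h => has (fun h' => (h != h')
    && [exists u : M, (h <= u)%MM && (h' <= u)%MM]) H) H).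
  have lcmu : (mdeg (mlcm h h') <= mdeg u)%N by rewrite mdeg_le // lem_mlcm hu.
  have [H' [degH' covH' szH' _ sumH']] :=
    merge_cover degH covH hH h'H hh' lcmu (ltnW (bmdeg u)).
  apply: (IHN H'); first by lia.
  by split=> //; have := bmdeg u; move: sumH'; lia.
exists H; split=> // h h' hH h'H u hu h'u.
move/hasPn/(_ h hH)/hasPn/(_ h' h'H): noOverlap; rewrite negb_and negbK.
by case/orP=> [/eqP//|/existsPn/(_ u)]; rewrite hu h'u.
Qed.

(** Walk along the row of the triangle of [g] with constant [z]-exponent [g z]. Two consecutive
    upward triangles have a common downward neighbour, and the member of [H] covering it covers
    both, so by disjointness the covering [h] never changes. Dividing both end labels, [h] divides
    [g]. *)
Lemma cover_triangle V H g : saturated V -> covers H V -> disjoint_cover H ->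
    (mdeg g < d)%N ->
    (forall u, is_up u || is_down u -> (g <= u)%MM -> u \in V) ->
  exists2 h, h \in H & (h <= g)%MM.
Proof.
move=> satV covH disjH gd gV; pose e := (d - (mdeg g).+1)%N.
have uxyz : uniq [:: x; y; z] by [].
have leE := mnm_le_coords _ _ uxyz; have degE := mdeg_coords _ uxyz.
have exU (a : nat) : (a <= e)%N ->
    exists u : M, [/\ is_up u, u x = (g x + (e - a))%N, u y = (g y + a)%N & u z = g z].
  move=> ae; have [v [vx vy vz]] := mnm_of_coords (g x + (e - a)) (g y + a) (g z) uxyz.
  have dv : (mdeg v).+1 = d by move: (degE v) (degE g); rewrite vx vy vz; lia.
  have ltv : (mdeg v < d)%N by rewrite dv.
  by exists (BMultinom ltv); rewrite /is_up /= dv.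
have [u0 [upu0 ux0 uy0 uz0]] := exU 0%N (leq0n _).
have gu0 : (g <= u0)%MM by rewrite leE; lia.
have uP0 : is_up u0 || is_down u0 by rewrite upu0.
have [h hH hu0] := hasP (covH _ (gV _ uP0 gu0) uP0).
exists h => //.
have walk (a : nat) : (a <= e)%N -> forall u, is_up u -> u x = (g x + (e - a))%N ->
    u y = (g y + a)%N -> u z = g z -> (h <= u)%MM.
  elim: a => [|a IHa] ae u upu ux uy uz.
    by rewrite (_ : u = u0) //; apply: val_inj; apply: (mnm_eq_coords uxyz) => /=; lia.
  have [u' [upu' ux' uy' uz']] := exU a (ltnW ae).
  have u'x : (0 < u' x)%N by lia.
  have [n dn nu'] := up_times upu' u'x.
  have nP : is_up n || is_down n by rewrite dn orbT.
  have tx := fun s => times_coord x s dn; have ty := fun s => times_coord y s dn.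
  have [nx ny nz] : [/\ (n x).+1 = u' x, n y = u' y & n z = u' z].
    by rewrite -nu' !tx.
  have gn : (g <= n)%MM by rewrite leE; lia.
  have [h' h'H h'n] := hasP (covH _ (gV _ nP gn) nP).
  have h'u' : (h' <= u')%MM by rewrite -nu' timesE // (lepm_trans h'n) // lem_addl.
  have e1 : h = h' := disjH h h' hH h'H u' (IHa (ltnW ae) _ upu' ux' uy' uz') h'u'.
  move: h'n; rewrite e1 !leE; lia.
have [ue [upue uxe uye uze]] := exU e (leqnn e).
have := walk e (leqnn e) ue upue uxe uye uze.
by move: hu0; rewrite !leE; lia.
Qed.
End Covers.

(** * Universal property of the gcd of a family *)

Section GcdMonomial.
Variables (m : nat) (g : 'I_m -> 'X_{1..3}).
Implicit Types (J : {set 'I_m}) (j : 'I_m).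

Lemma gcd_monomial_le J j : j \in J -> (gcd_monomial g J <= g j)%MM.
Proof.
move=> jJ; apply/mnm_lepP => k; rewrite mnmE.
move: (\max_(_ in _) _)%N => b; elim: (index_enum _) (mem_index_enum j) => // i r IHr.
rewrite big_cons inE => /predU1P[<-|/IHr le_r]; first by rewrite jJ geq_minl.
by case: ifP => // _; apply: leq_trans (geq_minr _ _) le_r.
Qed.

Lemma le_gcd_monomial J h : J != set0 -> (forall j, j \in J -> (h <= g j)%MM) ->
  (h <= gcd_monomial g J)%MM.
Proof.
move=> /set0Pn[j0 j0J] hJ; apply/mnm_lepP => k; rewrite mnmE.
have hk j : j \in J -> (h k <= g j k)%N by move=> /hJ /mnm_lepP.
elim/big_ind: _ => [|a b ha hb|j /hk //]; last by rewrite leq_min ha.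
(* The default value of the minimum is a maximum over the nonempty [J], hence also at least
   [h k]. *)
apply: leq_trans (hk j0 j0J) _.
by rewrite (bigD1 j0) //= leq_maxl.
Qed.

End GcdMonomial.

(** * From semistability to bounds by the excess of saturated sets *)

Section SlopeBound.
Variables (d m : nat) (g : 'I_m -> 'X_{1..3}) (t : rat).
Local Notation M := 'X_{1..3 < d}.
Implicit Types (J : {set 'I_m}) (j : 'I_m) (V : {set M}).

Definition total_side J : rat := \sum_(j in J) (d%:R - (mdeg (g j))%:R).

(* Brenner's inequalities for semistability when [t] is [o / (m - 1)], [o] being
   the over-puncturing coefficient: see [semistable_slopeE]. *)
Definition slope_bound := forall J, J != set0 ->
  total_side J <= d%:R - (mdeg (gcd_monomial g J))%:R + t * (#|J|%:R - 1).

(** Group the generators of [J] by the triangle of a disjoint cover of [V] that contains them, and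
    apply the slope bound to each class: its gcd is a multiple of the label of that triangle. There
    is at least one nonempty class, so the terms in [t] add up to at most [t * (#|J| - 1)]. *)
Lemma slope_bound_saturated V J : 0 <= t -> slope_bound -> saturated V ->
    (forall j, j \in J -> (mdeg (g j) < d)%N) ->
    (forall j, j \in J -> forall u, is_up u || is_down u -> (g j <= u)%MM -> u \in V) ->
    J != set0 ->
  total_side J <= (excess_set V)%:~R + t * (#|J|%:R - 1).
Proof.
move=> t0 slope satV degJ JV J0.
have [H [degH covH sumH disjH]] := disjoint_triangle_cover satV.
have exI j : j \in J -> exists i : 'I_(size H), (nth 0%MM H i <= g j)%MM.
  move=> jJ; have [h hH hg] := cover_triangle satV covH disjH (degJ j jJ) (JV j jJ).
  have ltH : (index h H < size H)%N by rewrite index_mem.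
  by exists (Ordinal ltH); rewrite /= nth_index.
have [j0 j0J] := set0Pn _ J0; have [i0 _] := exI j0 j0J.
have [phi phiP] : exists phi : 'I_m -> 'I_(size H),
    forall j, j \in J -> (nth 0%MM H (phi j) <= g j)%MM.
  apply: (@fin_all_exists _ (fun=> 'I_(size H)) (fun j i => j \in J -> (nth 0%MM H i <= g j)%MM)).
  by move=> j; case: (boolP (j \in J)) => [/exI[i]|]; [exists i | exists i0].
pose Ji i := [set j in J | phi j == i].
have sideE : (side_sum d H)%:~R
    = \sum_(i < size H) (d%:R - (mdeg (nth 0%MM H i))%:R) :> rat.
  rewrite /side_sum (big_nth 0%MM) big_mkord rmorph_sum.
  by apply: eq_bigr => i _; rewrite rmorphB.
(* The indicator replaces 1 so that the bound also holds for empty classes. *)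
have boundJi i : total_side (Ji i) <= (d%:R - (mdeg (nth 0%MM H i))%:R)
    + t * (#|Ji i|%:R - (Ji i != set0)%:R).
  have degh : (mdeg (nth 0%MM H i) < d)%N by rewrite (allP degH) // mem_nth.
  have [->|Ji0] := eqVneq (Ji i) set0.
    rewrite /total_side big_set0 cards0 subrr mulr0 addr0 subr_ge0 ler_nat.
    exact: ltnW.
  apply: le_trans (slope _ Ji0) _; rewrite lerD2r lerD2l lerN2 ler_nat.
  apply: mdeg_le; apply: le_gcd_monomial => // j; rewrite inE => /andP[jJ /eqP <-].
  exact: phiP.
have totalE : total_side J = \sum_i total_side (Ji i).
  rewrite /total_side (partition_big phi xpredT) //=; apply: eq_bigr => i _.
  by apply: eq_bigl => j; rewrite inE.
have cardE : #|J|%:R = \sum_i #|Ji i|%:R :> rat.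
  rewrite -natr_sum -sum1_card (partition_big phi xpredT) //=; congr _%:R.
  by apply: eq_bigr => i _; rewrite -sum1_card; apply: eq_bigl => j; rewrite inE.
have one_le : 1 <= \sum_i (Ji i != set0)%:R :> rat.
  have Ji0 : Ji (phi j0) != set0 by apply/set0Pn; exists j0; rewrite inE j0J eqxx.
  by rewrite (bigD1 (phi j0)) //= Ji0 lerDl sumr_ge0.
rewrite totalE (le_trans (ler_sum _ (fun i _ => boundJi i))) //.
rewrite big_split /= -sideE -mulr_sumr sumrB -cardE lerD ?ler_int //.
by rewrite ler_wpM2l // lerD2l lerN2.
Qed.

End SlopeBound.

(** * Tilings, weights and matchings *)

Section Tilings.
Variable d : nat.
Local Notation M := 'X_{1..3 < d}.
Implicit Types (T : {set M}) (f : M -> int).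

(** Each lozenge contributes [f (times i n) - f n], which is nonnegative. *)
Lemma tileable_excess T f : tileable T ->
    (forall n i, is_down n -> f n <= f (times i n)) ->
  0 <= excess (fun u => (u \in T)%:R * f u).
Proof.
move=> tileT fX.
pose s (u : M) : int := if is_up u then 1 else if is_down u then -1 else 0.
have -> : excess (fun u => (u \in T)%:R * f u) = \sum_(u in T) s u * f u.
  rewrite /excess [X in X - _]big_mkcond [X in _ - X]big_mkcond -sumrB [RHS]big_mkcond.
  apply: eq_bigr => u _; rewrite /s; case: ifP => upu.
    rewrite (negPf (up_not_down upu)) subr0 mul1r.
    by case: (u \in T); rewrite ?mul1r ?mul0r.
  by rewrite sub0r; case: ifP; case: (u \in T); rewrite ?mul1r ?mul0r ?mulN1r ?oppr0.
case: tileT => [->|[P [partP lozP]]]; first by rewrite big_set0.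
rewrite (set_partition_big _ partP); apply: sumr_ge0 => B /lozP[n [u [nu ->]]].
have [dn [i ->]] := share_edgeP _ _ nu.
have upt := times_up i dn; have ntd := up_not_down upt.
have nt : n != times i n by apply: contraTneq dn => ->.
rewrite big_setU1 ?inE // big_set1 /s upt dn.
have -> : is_up n = false by apply: contraTF dn => /up_not_down.
by rewrite /= mul1r mulN1r addrC subr_ge0 fX.
Qed.

(** The constant weights 1 and -1 are both monotone. *)
Lemma tileable_excess0 T : tileable T -> excess_set T = 0.
Proof.
move=> tileT; have mono c : 0 <= excess (fun u => (u \in T)%:R * c : int).
  exact: (@tileable_excess T (fun=> c)).
have eq0 : excess (fun u => (u \in T)%:R * 1 : int)
    + excess (fun u => (u \in T)%:R * -1 : int) = 0.
  by rewrite -excessD /excess !big1 ?subrr // => u _; rewrite mulrN subrr.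
have eq1 : excess_set T = excess (fun u => (u \in T)%:R * 1 : int).
  by apply: excess_ext => u _; rewrite mulr1.
by move: (mono 1) (mono (-1)) eq0; rewrite -eq1; move: (excess_set T) (excess _) => a b; lia.
Qed.

(** Balance makes the injective [f] reach every upward triangle of [T], so the pairs exhaust [T]. *)
Lemma matching_tileable T (f : M -> M) :
    {in T, forall u, is_up u || is_down u} -> excess_set T = 0 ->
    {in [set n in T | is_down n] &, injective f} ->
    {in [set n in T | is_down n], forall n, share_edge n (f n) /\ f n \in T} ->
  tileable T.
Proof.
move=> udT; rewrite excess_setE; set D := [set n in T | is_down n] => eqUD injf fP.
right; exists [set [set n; f n] | n in D].
set U := [set u in T | is_up u] in eqUD.
have DT n : n \in D -> n \in T by rewrite inE => /andP[].
have fU n : n \in D -> f n \in U.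
  by case/fP=> /share_edgeP[dn [i ->]] fT; rewrite inE fT times_up.
have imU : f @: D = U.
  apply/eqP; rewrite eqEcard card_in_imset //; apply/andP; split; last first.
    by move: eqUD; move: #|U| #|D| => a b; lia.
  by apply/subsetP=> _ /imsetP[n nD ->]; apply: fU.
have UD u : u \in U -> u \in D -> false.
  by rewrite !inE => /andP[_ /up_not_down/negPf->]; rewrite andbF.
have blockE n n' u : n \in D -> n' \in D -> u \in [set n; f n] ->
    u \in [set n'; f n'] -> n = n'.
  move=> nD n'D; rewrite !inE => /orP[]/eqP -> /orP[]/eqP // e.
  - by have := UD _ (fU _ n'D); rewrite -e nD => /(_ isT).
  - by have := UD _ (fU _ nD); rewrite e n'D => /(_ isT).
  - exact: injf.
split; last first.
  by move=> B /imsetP[n nD ->]; exists n, (f n); split=> //; have [] := fP n nD.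
apply/and3P; split.
- apply/eqP/setP=> u; apply/bigcupP/idP => [[_ /imsetP[n nD ->]]|uT].
    by rewrite !inE => /orP[/eqP->|/eqP->]; [apply: DT | have [] := fP n nD].
  have [upu|dnu] := orP (udT u uT).
    have : u \in f @: D by rewrite imU inE uT.
    case/imsetP=> n nD ->; exists [set n; f n]; first exact: imset_f.
    by rewrite !inE eqxx orbT.
  exists [set u; f u]; last by rewrite !inE eqxx.
  by apply: imset_f; rewrite inE uT.
- apply/trivIsetP=> _ _ /imsetP[n nD ->] /imsetP[n' n'D ->] nn'.
  apply/pred0P=> u; apply/negP => /andP[/= un un'].
  by move: nn'; rewrite (blockE n n' u nD n'D un un') eqxx.
- by apply/imsetP => -[n _ /setP/(_ n)]; rewrite !inE eqxx.
Qed.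

End Tilings.

(** * Punctures: overlaps, and the implications under perfect puncturing *)

Section Punctures.
Variables (d m : nat) (g : 'I_m -> 'X_{1..3}).
Hypothesis deg_le : forall j, (mdeg (g j) <= d)%N.
Local Notation M := 'X_{1..3 < d}.
Implicit Types (J : {set 'I_m}) (j : 'I_m) (u n : M) (i : 'I_3) (h : 'X_{1..3}).

Definition multiplicity u : nat := #|[set j | (g j <= u)%MM]|.
Definition punctured : {set M} := [set u : M | [exists j, (g j <= u)%MM]].
Definition unpunctured : {set M} :=
  [set u : M | (is_up u || is_down u) && (u \notin punctured)].
Definition nonoverlapping := forall u, is_up u || is_down u -> (multiplicity u <= 1)%N.

Lemma le_times h i n : is_down n -> (h <= n)%MM -> (h <= times i n)%MM.
Proof. by move=> dn hn; rewrite timesE // (lepm_trans hn) // lem_addl. Qed.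

Lemma puncturedE u : (u \in punctured) = (0 < multiplicity u)%N.
Proof.
rewrite inE; apply/existsP/card_gt0P => -[j]; first by exists j; rewrite inE.
by rewrite inE; exists j.
Qed.

Lemma multiplicity_times i n : is_down n ->
  (multiplicity n <= multiplicity (times i n))%N.
Proof.
move=> dn; apply: subset_leq_card; apply/subsetP=> j; rewrite !inE; exact: le_times.
Qed.

Lemma saturated_punctured : saturated punctured.
Proof.
by move=> n i dn; rewrite !puncturedE => /leq_trans; apply; apply: multiplicity_times.
Qed.

Lemma excess_one : excess (fun _ : M => 1) = d%:Z.
Proof.
transitivity (excess (fun u : M => (0%MM <= u)%MM%:R)).
  by apply: excess_ext => u _; rewrite (_ : (0 <= u)%MM) //; apply/mnm_lepP => k; rewrite mnm0E.
by rewrite excess_multiples ?mdeg0 ?subr0.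
Qed.

Lemma excess_total_side J :
  (excess (fun u : M => \sum_(j in J) (g j <= u)%MM%:R))%:~R = total_side d g J.
Proof.
rewrite excess_sum rmorph_sum; apply: eq_bigr => j _ /=.
by rewrite excess_multiples // rmorphB.
Qed.

Lemma multiplicity_sum u : (multiplicity u)%:R = \sum_(j in setT) (g j <= u)%MM%:R :> int.
Proof.
rewrite /multiplicity -sum1_card natr_sum big_mkcond [RHS]big_mkcond /=.
by apply: eq_bigr => j _; rewrite !inE; case: (g j <= u)%MM.
Qed.

Lemma excess_multiplicity :
  excess (fun u : M => (multiplicity u)%:R) = d%:Z + overpuncturing g d.
Proof.
rewrite (excess_ext (fun u _ => multiplicity_sum u)) excess_sum /overpuncturing.
rewrite addrCA subrr addr0; apply: eq_big => j; first by rewrite inE.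
by rewrite excess_multiples.
Qed.

Lemma total_side_setT : total_side d g setT = (d%:Z + overpuncturing g d)%:~R.
Proof.
rewrite -excess_multiplicity -excess_total_side; congr _%:~R.
by apply: excess_ext => u _; rewrite multiplicity_sum.
Qed.

Lemma excess_unpunctured : excess_set unpunctured = d%:Z - excess_set punctured.
Proof.
rewrite -excess_one /excess_set -excessB; apply: excess_ext => u uP.
by rewrite inE uP /=; case: (u \in punctured).
Qed.

(** The weight counts the punctures at [u] beyond the first, so its excess compares the total side
    of the punctures with the excess of their union. *)
Lemma excess_overlap :
  excess (fun u : M => (multiplicity u).-1%:R)
  = d%:Z + overpuncturing g d - excess_set punctured.
Proof.
rewrite -excess_multiplicity /excess_set -excessB; apply: excess_ext => u _.
by rewrite puncturedE; case: multiplicity => [|c] //=; rewrite -natrB // subn1.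
Qed.

Lemma overlap_mono i n : is_down n ->
  (multiplicity n).-1%:R <= (multiplicity (times i n)).-1%:R :> int.
Proof. by move=> /(multiplicity_times i); rewrite ler_nat; lia. Qed.

Lemma overpuncturing_ge0 : excess_set punctured = d%:Z -> 0 <= overpuncturing g d.
Proof.
have := @excess_ge0 d (@Ordinal 3 0 isT) (fun u => (multiplicity u).-1%:R)
  (fun _ _ => ler0n _ _) (overlap_mono _).
by rewrite excess_overlap; move: (overpuncturing _ _) (excess_set _) => a b; lia.
Qed.

Lemma nonoverlapping_up :
  (forall u, is_up u -> (multiplicity u <= 1)%N) ->
  nonoverlapping.
Proof.
move=> up1 u /orP[/up1 //|dn]; pose i := @Ordinal 3 0 isT.
exact: leq_trans (multiplicity_times i dn) (up1 _ (times_up i dn)).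
Qed.

(* If a label of degree [d-1] lay in two punctures, so would every label reached
   from it by trading a factor [x] for a factor [y]. *)
Lemma balanced_nonoverlapping :
    excess_set punctured = d%:Z -> overpuncturing g d = 0 ->
  nonoverlapping.
Proof.
move=> bal pp; apply: nonoverlapping_up.
pose x := @Ordinal 3 0 isT; pose y := @Ordinal 3 1 isT.
have eq0 : excess (fun u : M => (multiplicity u).-1%:R) = 0.
  by rewrite excess_overlap bal pp addr0 subrr.
have [stepx border] := excess_eq0 (fun _ _ => ler0n _ _) (@overlap_mono x) eq0.
suff main c u : is_up u -> u x = c -> (multiplicity u).-1 = 0%N.
  by move=> u upu; have := main _ u upu erefl; lia.
elim: c u => [|c IHc] u upu ux.
  by have /eqP := border u upu ux; rewrite pnatr_eq0 => /eqP.
have [|n dn nu] := @up_times _ x u upu; first by rewrite ux.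
have tyx : times y n x = c.
  by move: ux; rewrite -nu !times_coord //= => -[].
have := overlap_mono y dn; rewrite (IHc (times y n) (times_up y dn) tyx).
have /eqP := stepx n dn; rewrite nu eqr_nat => /eqP ->.
by rewrite ler_nat leqn0 => /eqP.
Qed.

Section NonOverlapping.
Hypothesis nonover : nonoverlapping.

Lemma multiple_unique u j j' : is_up u || is_down u ->
  (g j <= u)%MM -> (g j' <= u)%MM -> j = j'.
Proof.
move=> /nonover/card_le1_eqP eq1 ju j'u; apply: eq1; by rewrite inE.
Qed.

Lemma sum_multiples J u : is_up u || is_down u ->
  \sum_(j in J) (g j <= u)%MM%:R = [exists j in J, (g j <= u)%MM]%:R :> int.
Proof.
move=> uP; case: (boolP [exists j in J, (g j <= u)%MM]) => [|/exists_inPn noJ].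
  case/exists_inP=> j jJ ju; rewrite (bigD1 j) //= ju big1 ?addr0 // => j' /andP[_ jj'].
  by case: (boolP (g j' <= u)%MM) => // /(multiple_unique uP ju) e; rewrite e eqxx in jj'.
by rewrite big1 // => j /noJ /negPf->.
Qed.

Lemma nonoverlapping_balanced : overpuncturing g d = 0 -> excess_set punctured = d%:Z.
Proof.
move=> pp; rewrite -[RHS]addr0 -pp -excess_multiplicity; apply: excess_ext => u uP.
by rewrite puncturedE; have := nonover uP; case: (multiplicity u) => [|[]].
Qed.

End NonOverlapping.

(** Weight the tiling by the indicator of the triangle of [h]. The result is nonnegative and equals
    the side of that triangle, minus the total side of [J], minus the excess of what other punctures
    occupy there; the last excess is nonnegative, being that of a saturated set. *)
Lemma tileable_nonoverlapping_slope : tileable unpunctured -> overpuncturing g d = 0 ->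
  forall J, J != set0 -> total_side d g J <= d%:R - (mdeg (gcd_monomial g J))%:R.
Proof.
move=> tileT pp J J0; set h := gcd_monomial g J.
have bal : excess_set punctured = d%:Z.
  have := excess_unpunctured; rewrite (tileable_excess0 tileT).
  by move: (excess_set _) => b; lia.
have nonover := balanced_nonoverlapping bal pp.
have [j0 j0J] := set0Pn _ J0.
have hd : (mdeg h <= d)%N.
  exact: leq_trans (mdeg_le (gcd_monomial_le g j0J)) (deg_le j0).
pose hm u : int := (h <= u)%MM%:R.
have mono (P : M -> bool) : (forall n i, is_down n -> P n -> P (times i n)) ->
    forall n i, is_down n -> (P n)%:R <= (P (times i n))%:R :> int.
  by move=> PX n i dn; have := PX n i dn; case: (P n) => [->|_]; rewrite ?ler0n.
have hmX n i : is_down n -> hm n <= hm (times i n).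
  by apply: (mono (fun u : M => h <= u)%MM) => n' i' dn'; apply: le_times.
have := tileable_excess tileT hmX.
(* Punctures of [J] lie inside the triangle of [h] and, by disjointness, are not met by the other
   ones. *)
have -> : excess (fun u : M => (u \in unpunctured)%:R * hm u) =
    excess hm - excess (fun u : M => \sum_(j in J) (g j <= u)%MM%:R)
    - excess (fun u : M => ([exists j in ~: J, (g j <= u)%MM] && (h <= u)%MM)%:R).
  rewrite -!excessB; apply: excess_ext => u uP.
  rewrite (sum_multiples nonover) // !inE uP /= /hm.
  case: (boolP [exists j in J, (g j <= u)%MM]) => [/exists_inP[j jJ ju]|noJ].
    have hu : (h <= u)%MM := lepm_trans (gcd_monomial_le g jJ) ju.
    have -> : [exists j, (g j <= u)%MM] by apply/existsP; exists j.
    have -> : [exists j in ~: J, (g j <= u)%MM] = false.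
      apply/exists_inP => -[j']; rewrite inE => j'J /(multiple_unique nonover uP ju) e.
      by rewrite -e jJ in j'J.
    by rewrite hu /= mul0r subrr.
  have -> : [exists j, (g j <= u)%MM] = [exists j in ~: J, (g j <= u)%MM].
    apply/existsP/exists_inP => [[j ju]|[j _ ju]]; exists j => //.
    by rewrite inE; apply: contraNN noJ => jJ; apply/exists_inP; exists j.
  by case: [exists j in _, _]; case: (h <= u)%MM; rewrite /= ?mul1r ?mul0r ?subr0 ?subrr.
have : 0 <= excess (fun u : M => ([exists j in ~: J, (g j <= u)%MM] && (h <= u)%MM)%:R).
  apply: (@excess_ge0 _ (@Ordinal 3 0 isT)) => [u _|n dn]; first exact: ler0n.
  apply: (mono (fun u : M => [exists j in ~: J, (g j <= u)%MM] && (h <= u)%MM)) => //.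
  move=> n' i dn' /andP[/exists_inP[j jJ ju] hu]; rewrite le_times // andbT.
  by apply/exists_inP; exists j => //; apply: le_times.
rewrite -excess_total_side /hm excess_multiples //.
have -> : d%:R - (mdeg h)%:R = (d%:Z - (mdeg h)%:Z)%:~R :> rat by rewrite rmorphB.
rewrite ler_int; move: (excess _) (excess _) => a b; lia.
Qed.

(** For two generators the bound forces an lcm of degree at least [d], which cannot divide a
    label. *)
Lemma slope_nonoverlapping : slope_bound d g 0 ->
  nonoverlapping.
Proof.
move=> slope u _; apply/card_le1_eqP => j j'; rewrite !inE => ju j'u.
apply/eqP/negPn/negP => jj'; have := slope [set j; j'].
have sum2 : total_side d g [set j; j'] = (d%:R - (mdeg (g j))%:R) + (d%:R - (mdeg (g j'))%:R).
  by rewrite /total_side big_setU1 ?big_set1 // in_set1 eq_sym.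
have J0 : [set j; j'] != set0 by apply/set0Pn; exists j; rewrite !inE eqxx.
move=> /(_ J0); rewrite mul0r addr0 sum2.
move=> slopeJ; have : (gcd_mnm (g j) (g j') <= gcd_monomial g [set j; j'])%MM.
  apply: le_gcd_monomial => // k; rewrite !inE; have [le1 le2] := gcd_mnm_le (g j) (g j').
  by case/orP=> /eqP->.
move=> /mdeg_le gcd_le.
have lcm_le : (mdeg (mlcm (g j) (g j')) <= mdeg u)%N by rewrite mdeg_le // lem_mlcm ju.
have : (mdeg (g j) + mdeg (g j') < d + mdeg (gcd_monomial g [set j; j']))%N.
  by have := bmdeg u; have := mdeg_gcd (g j) (g j'); lia.
by rewrite -(ltr_nat rat) !natrD; lra.
Qed.

(** For Hall's condition, adjoin to [S] its unpunctured neighbours and the punctures [J] adjacent to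
    it. This set is saturated with excess [#|NS| - #|S|] plus the total side of [J], and the slope
    bound says that the latter is at most the excess. *)
Lemma slope_tileable : slope_bound d g 0 -> overpuncturing g d = 0 ->
  tileable unpunctured.
Proof.
move=> slope pp; have nonover := slope_nonoverlapping slope.
have excT : excess_set unpunctured = 0.
  by rewrite excess_unpunctured (nonoverlapping_balanced nonover) ?subrr.
have udT : {in unpunctured, forall u, is_up u || is_down u}.
  by move=> u; rewrite inE => /andP[].
have [noT|[t0 _]] := set_0Vmem unpunctured; first by left.
pose nbrs n := [set u in unpunctured | share_edge n u].
suff hall (S : {set M}) : S \subset [set n in unpunctured | is_down n] ->
    (#|S| <= #|\bigcup_(n in S) nbrs n|)%N.
  have [f injf fP] := hall_marriage t0 hall.
  apply: (matching_tileable udT excT injf) => n /fP.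
  by rewrite inE => /andP[].
move=> sS; set NS := \bigcup_(n in S) nbrs n.
have SP n : n \in S -> is_down n /\ n \notin punctured.
  by move=> /(subsetP sS); rewrite !inE => /andP[/andP[_ ->] ->].
pose J := [set j | [exists n in S, [exists i, (g j <= times i n)%MM]]].
pose V := S :|: NS :|: [set u : M | [exists j in J, (g j <= u)%MM]].
have JV j : j \in J -> forall u, is_up u || is_down u -> (g j <= u)%MM -> u \in V.
  by move=> jJ u _ ju; rewrite !inE; apply/orP; right; apply/exists_inP; exists j.
have degJ j : j \in J -> (mdeg (g j) < d)%N.
  rewrite inE => /exists_inP[n nS /existsP[i /mdeg_le]] /leq_ltn_trans; apply.
  exact: bmdeg.
have NSP u : u \in NS -> is_up u /\ u \notin punctured.
  case/bigcupP=> n nS; rewrite !inE => /andP[/andP[_ ->] /share_edgeP[dn [i ->]]].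
  by rewrite times_up.
have satV : saturated V.
  move=> n i dn; rewrite !in_setU => /orP[/orP[nS|/NSP[/up_not_down]]|]; last 2 first.
  - by rewrite dn.
  - rewrite inE => /exists_inP[j jJ jn]; apply/orP; right; rewrite inE.
    by apply/exists_inP; exists j => //; apply: le_times.
  case: (boolP (times i n \in punctured)) => tp.
    apply/orP; right; move: tp; rewrite !inE => /existsP[j jt].
    apply/exists_inP; exists j => //; rewrite inE.
    by apply/exists_inP; exists n => //; apply/existsP; exists i.
  apply/orP; left; apply/orP; right; apply/bigcupP; exists n => //.
  rewrite inE; apply/andP; split; first by rewrite inE times_up.
  by apply/share_edgeP; split=> //; exists i.
have excV : excess_set V = #|NS|%:Z - #|S|%:Z
    + excess (fun u : M => \sum_(j in J) (g j <= u)%MM%:R).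
  have -> : #|NS|%:Z - #|S|%:Z = excess_set (S :|: NS).
    rewrite excess_setE; congr (_%:Z - _%:Z); apply: eq_card => u; rewrite !inE.
      case: (boolP (u \in NS)) => [/NSP[->]|_]; rewrite ?orbT // orbF.
      by apply/esym/negP=> /andP[/SP[dnu _] /up_not_down]; rewrite dnu.
    case: (boolP (u \in S)) => [/SP[->]|_] //=.
    by apply/esym/negP=> /andP[/NSP[/up_not_down/negPf->]].
  rewrite /excess_set -excessD; apply: excess_ext => u uP.
  rewrite (sum_multiples nonover) // [u \in V]in_setU.
  have -> : (u \in [set u : M | [exists j in J, (g j <= u)%MM]])
    = [exists j in J, (g j <= u)%MM] by rewrite inE.
  case: (boolP [exists j in J, (g j <= u)%MM]) => [exJ|_]; last by rewrite orbF addr0.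
  have up : u \in punctured.
    by case/exists_inP: exJ => j _ ju; rewrite inE; apply/existsP; exists j.
  have -> : (u \in S :|: NS) = false by apply/negP; rewrite inE => /orP[/SP|/NSP] [_]; rewrite up.
  by rewrite add0r.
suff : 0 <= #|NS|%:Z - #|S|%:Z by rewrite subr_ge0 lez_nat.
(* The slope bound concerns nonempty [J]; for empty [J] it suffices that a saturated set has
   nonnegative excess. *)
have [J0|J0] := eqVneq J set0.
  have -> : #|NS|%:Z - #|S|%:Z = excess_set V.
    rewrite excV -[LHS]addr0; congr (_ + _).
    by rewrite /excess !big1 ?subrr // => u _; rewrite J0 big_set0.
  apply: (@excess_ge0 _ (@Ordinal 3 0 isT)) => [u _|n dn]; first exact: ler0n.
  by have := satV n (@Ordinal 3 0 isT) dn; case: (n \in V) => [->|_]; rewrite ?ler0n.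
have := slope_bound_saturated (lexx 0) slope satV degJ JV J0.
rewrite mul0r addr0 -excess_total_side ler_int excV lerDr.
by [].
Qed.
End Punctures.

(** * Connectedness of the rows of a saturated set of small excess *)

Section Rows.
Variables (d : nat) (V : {set 'X_{1..3 < d}}).
Hypotheses (satV : saturated V) (excV : excess_set V <= d%:Z).
Hypothesis rowV : forall (i : 'I_3) a, (a < d)%N ->
  exists u, [/\ u \in V, is_up u & u i = a].
Local Notation M := 'X_{1..3 < d}.
Implicit Types (u v w n : M) (i j k : 'I_3).

(* Multiplication by [x_j] maps the downward triangles of [V] into the upward
   ones and misses the element of least [x_j]-exponent of each of the [d] rows;
   as the excess of [V] is at most [d] it misses nothing else. *)
Lemma row_step i j k u v : uniq [:: i; j; k] -> u \in V -> v \in V ->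
    is_up u -> is_up v -> v i = u i -> (v j < u j)%N ->
  exists2 n, is_down n && (n \in V) & times j n = u.
Proof.
move=> uijk uV vV upu upv vi vj; have [ij _ jk] := uniq3_neq uijk.
pose U := [set u in V | is_up u]; pose D := [set n in V | is_down n].
have imD : times j @: D \subset U.
  by apply/subsetP=> _ /imsetP[n /[!inE] /andP[nV dn] ->]; rewrite satV ?times_up.
have cardW : (#|U :\: times j @: D| <= d)%N.
  rewrite cardsD (setIidPr imD) card_in_imset; last first.
    by move=> n n' /[!inE] /andP[_ dn] /andP[_ dn']; apply: times_inj.
  by move: excV; rewrite excess_setE -/U -/D; move: #|U| #|D| => a b; lia.
have exF (a : 'I_d) : exists w, [/\ w \in U :\: times j @: D, w i = a
    & forall w', w' \in V -> is_up w' -> w' i = a -> (w j <= w' j)%N].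
  have [w0 [w0V upw0 w0i]] := rowV i (ltn_ord a).
  pose P := [pred w : M | [&& w \in V, is_up w & w i == a]].
  have Pw0 : P w0 by rewrite /= w0V upw0 w0i eqxx.
  case: (@arg_minnP _ w0 P (fun w : M => w j) Pw0) => w /and3P[wV upw /eqP wi] wmin.
  exists w; split=> //; last by move=> w' w'V upw' w'i; apply: wmin; rewrite /= w'V upw' w'i eqxx.
  (* If [w] were [times j n], then [times k n] would lie in the same row with a smaller exponent of
     [j]. *)
  rewrite !inE wV upw !andbT; apply/negP=> /imsetP[n /[!inE] /andP[nV dn] ew].
  have [_ ik _] := uniq3_neq uijk.
  have tkP : P (times k n).
    rewrite /= satV // times_up //= -wi ew !times_coord //.
    by rewrite (eq_sym k i) (negPf ik) (eq_sym j i) (negPf ij).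
  have := wmin _ tkP; rewrite ew !times_coord // (eq_sym k j) (negPf jk) eqxx.
  by rewrite add1n add0n ltnn.
have [F FP] := fin_all_exists exF.
have injF : injective F.
  move=> a b eab; apply: val_inj; have [_ ea _] := FP a; have [_ eb _] := FP b.
  by rewrite /= -ea -eb eab.
have imF : F @: [set: 'I_d] = U :\: times j @: D.
  apply/eqP; rewrite eqEcard card_imset // cardsT card_ord cardW andbT.
  by apply/subsetP=> _ /imsetP[a _ ->]; have [] := FP a.
have [/imsetP[n /[!inE] /andP[nV dn] ->]|uD] := boolP (u \in times j @: D).
  by exists n; rewrite ?dn.
have : u \in F @: [set: 'I_d] by rewrite imF !inE uD uV.
case/imsetP=> a _ ua; have [_ ea amin] := FP a.
by have := amin v vV upv; rewrite vi ua ea => /(_ erefl); rewrite leqNgt -ua vj.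
Qed.

(** Start at the end [w] of the row. While the exponent of [j] is positive, [row_step], applied with
    the other end [v], allows a factor [j] to be traded for a factor [k] inside [V]; this descent
    meets [u]. *)
Lemma row_between i j k u v w : uniq [:: i; j; k] -> is_up u ->
    v \in V -> is_up v -> v i = u i -> v j = 0%N ->
    w \in V -> is_up w -> w i = u i -> w k = 0%N ->
  u \in V.
Proof.
move=> uijk upu vV upv vi vj; have degE := mdeg_coords _ uijk.
have [ij ik jk] := uniq3_neq uijk => wV upw wi wk.
suff main c w' : w' \in V -> is_up w' -> w' i = u i -> w' j = (u j + c)%N -> u \in V.
  apply: (main (w j - u j)%N w) => //.
  by move: upu upw; rewrite /is_up !degE wi wk; lia.
elim: c w' => [|c IHc] w' w'V upw' w'i w'j.
  rewrite addn0 in w'j; rewrite (_ : u = w') //.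
  apply: val_inj; apply: (mnm_eq_coords uijk) => //=.
  move: upu upw'; rewrite /is_up !degE w'i w'j => /eqP eu /eqP ew.
  by move: (etrans eu (esym ew)) => -[] /addnI.
have ltj : (v j < w' j)%N by rewrite vj w'j addnS.
have [n /andP[dn nV] nw] := row_step uijk w'V vV upw' upv (etrans vi (esym w'i)) ltj.
have tc i' s := times_coord i' s dn.
apply: (IHc (times k n)); rewrite ?satV ?times_up //.
  by move: w'i; rewrite -nw !tc (eq_sym k i) (negPf ik) (eq_sym j i) (negPf ij).
by move: w'j; rewrite -nw !tc eqxx (eq_sym k j) (negPf jk) addnS => -[].
Qed.

(** The three corners lie in [V], hence so do the sides between them, hence every row, whose ends
    are on the sides. *)
Lemma all_rows_hit u : is_up u -> u \in V.
Proof.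
have border i w : is_up w -> w i = 0%N -> w \in V.
  move=> upw wi; have [j [k uijk]] := exists_uniq3 i; have degE := mdeg_coords _ uijk.
  (* In each direction the row of exponent [d - 1] is a single corner. *)
  have ltd : (d.-1 < d)%N by move: upw; rewrite /is_up; lia.
  have [v [vV upv vk]] := rowV k ltd; have [v' [v'V upv' v'j]] := rowV j ltd.
  apply: (row_between uijk upw vV upv _ _ v'V upv').
  - by move: upv; rewrite /is_up degE; lia.
  - by move: upv; rewrite /is_up degE; lia.
  - by move: upv'; rewrite /is_up degE; lia.
  - by move: upv'; rewrite /is_up degE; lia.
move=> upu; pose i := @Ordinal 3 0 isT; pose j := @Ordinal 3 1 isT.
pose k := @Ordinal 3 2 isT; have uijk : uniq [:: i; j; k] by [].
have degE := mdeg_coords _ uijk.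
have exB b c : (u i + b + c).+1 = d -> exists w, [/\ is_up w, w i = u i, w j = b & w k = c].
  move=> sumd; have [v [vi vj vk]] := mnm_of_coords (u i) b c uijk.
  have dv : (mdeg v).+1 = d by rewrite degE vi vj vk.
  have ltv : (mdeg v < d)%N by rewrite dv.
  by exists (BMultinom ltv); rewrite /is_up /= dv eqxx.
have degu : (u i + (u j + u k)).+1 = d by move: upu; rewrite /is_up degE; lia.
have [v [upv vi vj vk]] := exB 0%N (u j + u k)%N ltac:(lia).
have [w [upw wi wj wk]] := exB (u j + u k)%N 0%N ltac:(lia).
exact: (row_between uijk upu (border _ _ upv vj) upv vi vj (border _ _ upw wk) upw wi wk).
Qed.

End Rows.

(** * A balanced region with positive over-puncturing is empty *)

Section Overpunctured.
Variables (d m : nat) (g : 'I_m -> 'X_{1..3}) (t : rat).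
Hypothesis deg_le : forall j, (mdeg (g j) <= d)%N.
Hypothesis balanced : excess_set (punctured d g) = d%:Z.
Hypothesis pure_power : forall i, exists j, forall s, s != i -> g j s = 0%N.
Hypothesis slope : slope_bound d g t.
Hypothesis m_gt1 : (1 < m)%N.
Hypothesis tE : t * (m%:R - 1) = (overpuncturing g d)%:~R.
Hypothesis t_gt0 : 0 < t.
Local Notation M := 'X_{1..3 < d}.
Local Notation P := (punctured d g).
Implicit Types (u n : M) (i : 'I_3) (j : 'I_m).

Lemma overpunctured_total : total_side d g setT = d%:R + t * (m%:R - 1).
Proof. by rewrite total_side_setT // rmorphD tE. Qed.

(** Generators of degree [d] add nothing to the total side, while omitting them would lower the
    bound [d + t * (#|J| - 1)] below that total. *)
Lemma overpunctured_deg_lt j : (mdeg (g j) < d)%N.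
Proof.
pose J := [set j | (mdeg (g j) < d)%N]; suff /setP/(_ j): J = setT by rewrite !inE.
have totJ : total_side d g J = d%:R + t * (m%:R - 1).
  rewrite -overpunctured_total /total_side.
  rewrite [RHS](bigID (mem J)) /= [X in _ + X]big1 ?addr0; last first.
    move=> i; rewrite !inE -leqNgt => /= le_d.
    by rewrite (_ : mdeg (g i) = d) ?subrr //; apply/eqP; rewrite eqn_leq deg_le.
  by apply: eq_bigl => i; rewrite in_setT.
have m1 : 0 < m%:R - 1 :> rat by rewrite subr_gt0 ltr1n.
have J0 : J != set0.
  apply: contraTneq (mulr_gt0 t_gt0 m1) => J0; rewrite -leNgt.
  have := ler0n rat d; move: totJ; rewrite J0 /total_side big_set0.
  by move: (t * _) => a; lra.
have JV j' : j' \in J -> forall u, is_up u || is_down u -> (g j' <= u)%MM -> u \in P.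
  by move=> _ u _ j'u; rewrite inE; apply/existsP; exists j'.
have degJ j' : j' \in J -> (mdeg (g j') < d)%N by rewrite inE.
have := slope_bound_saturated (ltW t_gt0) slope (@saturated_punctured d m g) degJ JV J0.
rewrite totJ balanced lerD2l ler_pM2l // lerD2r ler_nat => le_mJ.
by apply/eqP; rewrite eqEcard subsetT cardsT card_ord.
Qed.

(** A missed row splits the punctured set into two saturated parts and the generators into two
    nonempty families. Adding the two bounds gives a total side of at most [d + t * (m - 2)], a
    contradiction. *)
Lemma overpunctured_row i a : (a < d)%N -> exists u, [/\ u \in P, is_up u & u i = a].
Proof.
move=> ad.
have [/existsP[u /and3P[uP upu /eqP ui]]|/existsPn noRow] :=
  boolP [exists u : M, [&& u \in P, is_up u & u i == a]]; first by exists u.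
exfalso; have [i1 [i2 uiii]] := exists_uniq3 i; have [ii1 ii2 _] := uniq3_neq uiii.
have leE := mnm_le_coords _ _ uiii; have degE := mdeg_coords _ uiii.
(* A punctured downward triangle in the row would have a punctured upward neighbour there. *)
have offRow u : u \in P -> is_up u || is_down u -> u i != a.
  move=> uP /orP[upu|du].
    by have := noRow u; rewrite uP upu.
  have := noRow (times i1 u); rewrite saturated_punctured // times_up // times_coord //.
  by rewrite (eq_sym i1 i) (negPf ii1).
pose Vlow := [set u in P | (u i < a)%N]; pose Vhigh := [set u in P | (a < u i)%N].
have satlow : saturated Vlow.
  move=> n s dn; rewrite !inE => /andP[nP ni].
  have tP : times s n \in P by rewrite saturated_punctured // inE.
  have := offRow _ tP; rewrite times_up // => /(_ isT); move: tP; rewrite inE => ->.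
  by rewrite times_coord //; case: (s == i) => /=; lia.
have sathigh : saturated Vhigh.
  move=> n s dn; rewrite !inE => /andP[nP ni].
  have : times s n \in P by rewrite saturated_punctured // inE.
  by rewrite inE => ->; rewrite times_coord //; lia.
have exc : excess_set Vlow + excess_set Vhigh = d%:Z.
  rewrite -balanced /excess_set -excessD; apply: excess_ext => u uP.
  rewrite [u \in Vlow]in_set [u \in Vhigh]in_set; case: (boolP (u \in P)) => //= uPu.
  by have := offRow u uPu uP; case: ltngtP.
pose J := [set j | (g j i <= a)%N].
have Jlow j : j \in J -> forall u, is_up u || is_down u -> (g j <= u)%MM -> u \in Vlow.
  rewrite inE => ja u uP ju; have uPu : u \in P by rewrite inE; apply/existsP; exists j.
  rewrite inE uPu /= ltnNge; apply/negP => au.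
  (* This multiple of [g j] would be an upward triangle of the missed row. *)
  have [v [vi v1 v2]] := mnm_of_coords a (g j i1) (d - 1 - a - g j i1) uiii.
  have degu : (mdeg u < d)%N := bmdeg u; move: ju; rewrite leE => /and3P[j0 j1 j2].
  have dv : (mdeg v).+1 = d by move: (degE v) (degE u); rewrite vi v1 v2; lia.
  have ltv : (mdeg v < d)%N by rewrite dv.
  have := noRow (BMultinom ltv); rewrite /is_up /= dv vi !eqxx !andbT => /negP; apply.
  rewrite inE; apply/existsP; exists j; rewrite leE /= vi v1 v2 ja leqnn /=.
  by move: (degE u); lia.
have Jhigh j : j \in ~: J -> forall u, is_up u || is_down u -> (g j <= u)%MM -> u \in Vhigh.
  rewrite !inE -ltnNge => ja u uP ju.
  rewrite [_ \in Vhigh]inE; apply/andP; split; first by rewrite inE; apply/existsP; exists j.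
  exact: leq_trans ja (mnm_lepP ju i).
have J0 : J != set0.
  have [j jp] := pure_power i1; apply/set0Pn; exists j; by rewrite inE jp.
(* The power of the variable [i] belongs to the upper family, since its triangle contains the corner
   with exponent [d - 1]. *)
have [j jp] := pure_power i.
have jJ : j \in ~: J.
  rewrite inE; apply/negP => jJ; have degj := overpunctured_deg_lt j.
  have [v [vi v1 v2]] := mnm_of_coords (d - 1) 0 0 uiii.
  have dv : (mdeg v).+1 = d by rewrite degE vi v1 v2; lia.
  have ltv : (mdeg v < d)%N by rewrite dv.
  have ju : (g j <= BMultinom ltv)%MM.
    have [g1 g2] : g j i1 = 0%N /\ g j i2 = 0%N by rewrite !jp // eq_sym.
    by move: degj; rewrite leE degE /= g1 g2 vi v1 v2; lia.
  have := Jlow j jJ (BMultinom ltv); rewrite /is_up /= dv eqxx ju !inE /= vi.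
  by move=> /(_ isT isT)/andP[_]; lia.
have JC0 : ~: J != set0 by apply/set0Pn; exists j.
have lowB := slope_bound_saturated (ltW t_gt0) slope satlow
  (fun j _ => overpunctured_deg_lt j) Jlow J0.
have highB := slope_bound_saturated (ltW t_gt0) slope sathigh
  (fun j _ => overpunctured_deg_lt j) Jhigh JC0.
have tot : total_side d g J + total_side d g (~: J) = d%:R + t * (m%:R - 1).
  rewrite -overpunctured_total /total_side.
  rewrite [RHS](bigID (mem J)) /=; congr (_ + _); apply: eq_bigl => j'; by rewrite !inE.
have cardJ : #|J|%:R + #|~: J|%:R = m%:R :> rat by rewrite -natrD cardsC card_ord.
have := lerD lowB highB; rewrite tot addrACA -rmorphD /= exc lerD2l -mulrDr ler_pM2l //.
by rewrite -cardJ; lra.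
Qed.

(** No upward triangle is left, and by balance no downward one either. *)
Lemma overpunctured_unpunctured0 : unpunctured d g = set0.
Proof.
have up_punctured u : is_up u -> u \in P.
  apply: all_rows_hit; [exact: saturated_punctured | by rewrite balanced | exact: overpunctured_row].
have := excess_unpunctured d g; rewrite balanced subrr excess_setE.
have -> : [set u in unpunctured d g | is_up u] = set0.
  apply/setP=> u; rewrite !inE; apply/negP => /andP[/andP[_ uP] upu].
  by have := up_punctured u upu; rewrite inE (negPf uP).
rewrite cards0 sub0r => /eqP; rewrite oppr_eq0 eqz_nat cards_eq0 => /eqP noDown.
apply/setP=> u; rewrite in_set0; apply/negP => uT.
have := in_set0 u; rewrite -noDown inE uT /=; move: uT; rewrite in_set => /andP[uP uP'].
by case/orP: uP => [/up_punctured|->] //; rewrite (negPf uP').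
Qed.

End Overpunctured.

(** * Monomial ideals and their generators *)

Section MonomialIdeal.
Variable K : fieldType.
Implicit Types (I : {pred {mpoly K[3]}}) (u : 'X_{1..3}).

Lemma msupp_in_gen_ideal m (g : 'I_m -> 'X_{1..3}) P (p : {mpoly K[3]}) u :
  in_gen_ideal g P p -> u \in msupp p -> exists2 j, P j & (g j <= u)%MM.
Proof.
move=> [c ->] /msupp_sum_le /flattenP[s /mapP[j]].
rewrite mem_filter => /andP[Pj _] -> /msuppM_le /allpairsP[[v w] /= [_]].
rewrite msuppX inE => /eqP-> ->; exists j => //; exact: lem_addl.
Qed.

Lemma in_gen_idealX m (g : 'I_m -> 'X_{1..3}) (P : pred 'I_m) j u :
  P j -> (g j <= u)%MM -> in_gen_ideal g P ('X_[u] : {mpoly K[3]}).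
Proof.
move=> Pj ju; exists (fun i => if i == j then 'X_[(u - g j)%MM] else 0).
rewrite (bigD1 j) //= eqxx -mpolyXD submK // big1 ?addr0 // => i /andP[_ /negPf->].
by rewrite mul0r.
Qed.

Variables (I : {pred {mpoly K[3]}}) (m : nat) (g : 'I_m -> 'X_{1..3}).
Hypothesis genI : generated_by I g.

Lemma mem_monomial u : ('X_[u] \in I) = [exists j, (g j <= u)%MM].
Proof.
apply/idP/existsP => [/genI inI|[j ju]]; last exact/genI/(in_gen_idealX _ ju).
by have [|j _ ju] := msupp_in_gen_ideal inI (u := u); [rewrite msuppX inE | exists j].
Qed.

Lemma mem_monomial_ideal p : p \in I -> {in msupp p, forall u, 'X_[u] \in I}.
Proof.
move=> /genI inI u up; have [j _ ju] := msupp_in_gen_ideal inI up.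
by rewrite mem_monomial; apply/existsP; exists j.
Qed.

(* The ideals [I + (x_i^n)] form a descending chain. *)
Lemma artinian_pure_power (i : 'I_3) : artinian I ->
  exists j, forall s, s != i -> g j s = 0%N.
Proof.
pose Q n u := ('X_[u] \in I) || (n <= u i)%N.
move=> /(_ (fun n => [pred p | all (Q n) (msupp p)])) [n|N stab].
  have QD u v : Q n u -> Q n (v + u)%MM.
    rewrite /Q !mem_monomial mnmDE => /orP[/existsP[j ju]|le_n]; apply/orP.
      by left; apply/existsP; exists j; apply: lepm_trans ju (lem_addl _ _).
    by right; apply: leq_trans le_n (leq_addl _ _).
  split.
  - split=> [|p q /allP pQ /allP qQ|a p /allP pQ]; first by rewrite inE msupp0.
      apply/allP=> u /msuppD_le; rewrite mem_cat => /orP[/pQ|/qQ] //.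
    by apply/allP=> u /msuppM_le /allpairsP[[v w] /= [_ /pQ Qw ->]]; apply: QD.
  - by move=> p pI; apply/allP=> u up; rewrite /Q (mem_monomial_ideal pI up).
  - by move=> p /allP pQ; apply/allP=> u /pQ /orP[] le_n; rewrite /Q ?le_n ?(ltnW le_n) ?orbT.
(* The power [N] of the variable lies in member [N] of the chain, hence in member [N.+1], hence in
   [I]. *)
have := stab N.+1 (leqnSn N) 'X_[U_(i) *+ N].
rewrite !inE !msuppX /= !andbT /Q !mulmnE mnm1E eqxx mul1n leqnn orbT ltnn orbF.
rewrite mem_monomial => /existsP[j jN]; exists j => s si.
have := mnm_lepP jN s; rewrite mulmnE mnm1E eq_sym (negPf si) mul0n.
by rewrite leqn0 => /eqP.
Qed.

End MonomialIdeal.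

(** Some given generator [g' k] divides [g j] and is itself a multiple of some [g j']; minimality
    forces [j' = j], so [g j] divides [g' k]. *)
Lemma minimal_generators_mdeg_le (K : fieldType) d (I : {pred {mpoly K[3]}})
    m (g : 'I_m -> 'X_{1..3}) :
  generated_by_monomials_le d I -> minimal_generators I g ->
  forall j, (mdeg (g j) <= d)%N.
Proof.
move=> [m' [g' [genI' deg']]] [genI minI] j.
have : 'X_[g j] \in I by rewrite (mem_monomial genI); apply/existsP; exists j; apply: lepm_refl.
rewrite (mem_monomial genI') => /existsP[k kj].
have : 'X_[g' k] \in I by rewrite (mem_monomial genI'); apply/existsP; exists k; apply: lepm_refl.
rewrite (mem_monomial genI) => /existsP[j' j'k].
have [ej|nj] := eqVneq j' j; first by rewrite -ej (leq_trans (mdeg_le j'k)).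
by case: (minI j); apply: in_gen_idealX nj (lepm_trans j'k kj).
Qed.

(** * Brenner's criterion as a slope bound *)

Section Semistability.
Variables (d m : nat) (g : 'I_m -> 'X_{1..3}).
Hypothesis m_gt1 : (1 < m)%N.
Let t : rat := (overpuncturing g d)%:~R / (m%:R - 1).
Implicit Types J : {set 'I_m}.

Lemma overpuncturingE :
  (overpuncturing g d)%:~R = m%:R * d%:R - \sum_(i < m) (mdeg (g i))%:R - d%:R :> rat.
Proof.
rewrite /overpuncturing rmorphB rmorph_sum /=; congr (_ - _).
under eq_bigr => i _ do rewrite rmorphB.
by rewrite sumrB sumr_const card_ord mulr_natl.
Qed.

(** The slope of the whole bundle is [t - d]; clearing the denominator [#|J| - 1] gives the
    bound. *)
Lemma semistable_slopeE J : (1 < #|J|)%N ->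
  (((mdeg (gcd_monomial g J))%:R - \sum_(j in J) (mdeg (g j))%:R) / (#|J|%:R - 1)
    <= (- \sum_(i < m) (mdeg (g i))%:R) / (m%:R - 1) :> rat)
  = (total_side d g J <= d%:R - (mdeg (gcd_monomial g J))%:R + t * (#|J|%:R - 1)).
Proof.
move=> J1; have r0 : 0 < #|J|%:R - 1 :> rat by rewrite subr_gt0 ltr1n.
have s0 : 0 < m%:R - 1 :> rat by rewrite subr_gt0 ltr1n.
rewrite ler_pdivrMr // /t overpuncturingE.
have -> : total_side d g J = #|J|%:R * d%:R - \sum_(j in J) (mdeg (g j))%:R.
  by rewrite /total_side sumrB sumr_const mulr_natl.
set a := _%:R; set b := \sum_(j in J) _; set c := \sum_(_ < _) _.
set r := #|J|%:R in r0 *; set s := m%:R in s0 *; set e := d%:R.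
have -> : (s * e - c - e) / (s - 1) * (r - 1) = - c / (s - 1) * (r - 1) + e * (r - 1).
  by field; lra.
by rewrite -subr_ge0 -[RHS]subr_ge0; congr (0 <= _); ring.
Qed.

Lemma semistable_slope_bound :
  slope_bound d g t -> syzygy_bundle_semistable g.
Proof.
by move=> slope J _ J1; rewrite semistable_slopeE // slope // -card_gt0 ltnW.
Qed.

(** Two cases lie outside Brenner's criterion: for singletons the bound is immediate, and for the
    full family, whose gcd is 1 because of the pure powers, it is an equality. *)
Lemma slope_bound_semistable :
  (forall i, exists j, forall s, s != i -> g j s = 0%N) ->
  (forall j, (mdeg (g j) <= d)%N) ->
  syzygy_bundle_semistable g -> slope_bound d g t.
Proof.
move=> pure deg_le ss J J0.
have [J1|] := ltnP 1 #|J|; last first.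
  rewrite leq_eqVlt ltnS leqn0 cards_eq0 (negPf J0) orbF => /cards1P[j ->].
  rewrite cards1 subrr mulr0 addr0 /total_side big_set1 lerD2l lerN2 ler_nat.
  by rewrite mdeg_le // gcd_monomial_le ?inE.
have [->|JT] := eqVneq J setT; last first.
  by rewrite -semistable_slopeE //; apply: ss => //; rewrite properEneq JT subsetT.
have s0 : m%:R - 1 != 0 :> rat by rewrite subr_eq0 pnatr_eq1; lia.
rewrite (total_side_setT deg_le) cardsT card_ord /t divfK //.
have -> : mdeg (gcd_monomial g setT) = 0%N.
  apply/eqP; rewrite mdeg_eq0; apply/eqP/mnmP=> s; rewrite mnm0E.
  have [i [_ /uniq3_neq[si _ _]]] := exists_uniq3 s; have [j jp] := pure i.
  by have := mnm_lepP (gcd_monomial_le g (in_setT j)) s; rewrite jp // leqn0 => /eqP.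
by rewrite subr0 rmorphD.
Qed.

End Semistability.

Theorem theorem4p5
  (K : fieldType) (charK0 : [pchar K] =i pred0)
  (d : nat) (d_gt0 : (0 < d)%N)
  (I : {pred {mpoly K[3]}})
  (genI : generated_by_monomials_le d I)
  (artI : artinian I)
  (m : nat) (g : 'I_m -> 'X_{1..3}) (minI : minimal_generators I g)
  (T_neq0 : region d I <> set0) :
  [/\ perfectly_punctured g d -> tileable (region d I) ->
        syzygy_bundle_semistable g,
      perfectly_punctured g d -> syzygy_bundle_semistable g ->
        tileable (region d I)
    & tileable (region d I) -> syzygy_bundle_semistable g ->
        perfectly_punctured g d].
Proof.
have genIg : generated_by I g by case: minI.
have deg_le := minimal_generators_mdeg_le genI minI.
have pure i := artinian_pure_power genIg i artI.
have regionE : region d I = unpunctured d g.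
  by apply/setP=> u; rewrite !inE (mem_monomial genIg).
rewrite regionE in T_neq0 *.
(* A single generator would be a power of two different variables, hence 1, and the region would be
   empty. *)
have m_gt1 : (1 < m)%N.
  rewrite ltnNge; apply/negP => m1; apply: T_neq0; apply/setP=> u; rewrite !inE.
  have [x [y /uniq3_neq[xy _ _]]] : exists i j : 'I_3, uniq [:: i; j; ord0].
    by exists (@Ordinal 3 1 isT), (@Ordinal 3 2 isT).
  have [jx jxP] := pure x; have [jy jyP] := pure y.
  have jxy : jx = jy by apply: val_inj => /=; have := ltn_ord jx; have := ltn_ord jy; lia.
  have g0 : g jx = 0%MM.
    apply/mnmP=> s; rewrite mnm0E; have [->|sx] := eqVneq s x; last exact: jxP.
    by rewrite jxy jyP.
  apply/negP => /andP[_ /existsPn /(_ jx)] /negP; apply; rewrite g0.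
  by apply/mnm_lepP => s; rewrite mnm0E.
split=> [pp tileT|pp ss|tileT ss].
- apply: (@semistable_slope_bound d) => // J J0; rewrite pp mul0r mul0r addr0.
  exact: tileable_nonoverlapping_slope.
- apply: slope_tileable => //; have := slope_bound_semistable m_gt1 pure deg_le ss.
  by rewrite pp mul0r.
- have balanced : excess_set (punctured d g) = d%:Z.
    have := excess_unpunctured d g; rewrite (tileable_excess0 tileT).
    by move: (excess_set _) => b; lia.
  (* Balance excludes negative over-puncturing; a positive one would make the region empty. *)
  apply/eqP; rewrite eq_le overpuncturing_ge0 // andbT leNgt; apply/negP => o_gt0.
  have s0 : 0 < m%:R - 1 :> rat by rewrite subr_gt0 ltr1n.
  apply: T_neq0; apply: (overpunctured_unpunctured0 deg_le balanced pure
    (slope_bound_semistable m_gt1 pure deg_le ss) m_gt1).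
  + by rewrite divfK // gt_eqF.
  + by rewrite divr_gt0 // ltr0z.
Qed.
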